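(* Let $u,v\in S_n$ and let $I=I(v)$ be the particular reduced word for $v$ described in the context. Then $F_I\colon\mathcal{C}_0(u,v)\to\mathcal{R}(u,I)$ is a bijection and $$SC(F_I(\gamma),I)=E(\gamma)$$ for all chains $\gamma\in\mathcal{C}_0(u,v)$.
   Context: $S_n$ is the Weyl group of type $A_{n-1}$, with simple roots $\alpha_i=x_i-x_{i+1}$ ($1\leq i\leq n-1$), positive roots $x_i-x_j$ ($i<j$), action $w\cdot x_i=x_{w(i)}$, simple transpositions $s_i=(i,i+1)$, and length $\ell$. For a word $K=[i_1,\dots,i_r]$ put $s_K=s_{i_1}\cdots s_{i_r}$ (identity if $K$ is empty, and $s_0$ is the identity). **The word $I(v)$.** $I(v)=[I_1,I_2,\dots,I_{n-1}]$ (concatenation) is the reduced word for $v$ in which, for each $j=1,\dots,n-1$, either $I_j=[k_j,k_j-1,\dots,j+1,j]$ for some $k_j$ with $j\leq k_j\leq n-1$, or $I_j$ is empty. **Chains.** $\mathcal{C}_0(u,v)$ is the set of chains $$\gamma:\ u=u_0\xrightarrow{*(i_1,j_1)}u_1\xrightarrow{*(i_2,j_2)}\cdots\xrightarrow{*(i_m,j_m)}u_m=v$$ with $u_k=u_{k-1}(i_k,j_k)$, $i_k<j_k$, $u_{k-1}(i_k)<u_{k-1}(j_k)$, $\ell(u_k)=\ell(u_{k-1})+1$ for all $k$, and $i_1\leq i_2\leq\dots\leq i_m$. With $\mathrm{Inv}(v)=\{(v(j),v(i)) : i<j,\ v(i)>v(j)\}$, put $$E(\gamma)=\prod_{(a,b)\in\mathrm{Inv}(v)\setminus\{(u_{k-1}(i_k),v(i_k))\,:\,k=1,\dots,m\}}(x_a-x_b).$$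 **Subwords.** For a reduced word $I=[i_1,\dots,i_r]$ for $v$, a subword of $I$ is $J=[\epsilon_1i_1,\dots,\epsilon_ri_r]$ with $\epsilon_k\in\{0,1\}$; replacing a letter by $0$ is called deleting it. $\mathcal{R}(u,I)$ is the set of subwords of $I$ that, after removing the zeroes, are reduced words for $u$. The subword contribution is $SC(J,I)=\prod_{j:\,\epsilon_j=1}s_{i_1}\cdots s_{i_{j-1}}\alpha_{i_j}$. **The map $F_I$.** Given a chain $\gamma:\ u=u_0\xrightarrow{*(i_1,j_1)}u_1\xrightarrow{*(i_2,j_2)}\cdots\xrightarrow{*(i_m,j_m)}u_m=v$ in $\mathcal{C}_0(u,v)$, set $J_m=I$ and, for $k=m,m-1,\dots,1$, let $J_{k-1}$ be the subword obtained from $J_k$ by deleting the unique nonzero letter whose deletion produces a word for $u_{k-1}$ (such a letter exists and is unique by the Strong Exchange Property, since $J_k$ with zeroes removed is a reduced word for $u_k$). Then $F_I(\gamma)=J_0$. *)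

(* Defs.v *)
From HB Require Import structures.
From mathcomp Require Export all_boot all_order all_algebra all_fingroup.
From mathcomp Require Export mpoly.
From mathcomp Require Import zify.

Set Implicit Arguments.
Unset Strict Implicit.
Unset Printing Implicit Defensive.

Import GRing.Theory.

(* The symmetric group on n+1 letters, acting on the 0-based points
   0, ..., n of 'I_n.+1; the root system is of type A_n and the variable
   x_(a+1) is 'X_a.  The letters of a word are elements of 'I_n.+1 too: the
   letters 1, ..., n are the indices of the simple transpositions, and the
   letter 0 stands for a deleted one. *)

Section Words.
Variable n : nat.
Implicit Types (u v w : 'S_n.+1) (i : 'I_n.+1) (I J K : seq 'I_n.+1).

(* u \oc w is the map x |-> u (w x): products of permutations are written
   right to left, while fingroup's product applies its left factor first. *)
Definition compp u w : 'S_n.+1 := (w * u)%g.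
Local Notation "u \oc w" := (compp u w) (at level 40, left associativity).

Definition opred i : 'I_n.+1 := inord i.-1.

(* s_i exchanges the (1-based) points i and i+1; s_0 = 1 since opred 0 = 0. *)
Definition simple i : 'S_n.+1 := tperm (opred i) i.

Definition word_perm K : 'S_n.+1 := foldr (fun i w => simple i \oc w) 1%g K.

Definition word_of K w : bool := (ord0 \notin K) && (word_perm K == w).

(* For j >= 1 : the empty word, or k, k-1, ..., j+1, j with j <= k <= n. *)
Definition block (j : nat) (B : seq nat) : Prop :=
  B = [::] \/ exists2 k, j <= k <= n & B = rev (iota j (k.+1 - j)).

Definition block_word I : Prop :=
  exists2 B : nat -> seq nat, (forall j, 1 <= j <= n -> block j (B j))
    & [seq val i | i <- I] = flatten [seq B j | j <- iota 1 n].

(* By positions; used only to show that the words I(v) exist and are reduced. *)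
Definition inversions w : {set 'I_n.+1 * 'I_n.+1} :=
  [set p : 'I_n.+1 * 'I_n.+1 | (p.1 < p.2) && (w p.2 < w p.1)].

Lemma val_opred i : opred i = i.-1 :> nat.
Proof. by rewrite inordK //; have := ltn_ord i; lia. Qed.

Lemma simple_lt i (x y : 'I_n.+1) : simple i x < simple i y ->
  x < y \/ x = i /\ y = opred i.
Proof.
have E (a b : 'I_n.+1) : a <> b -> nat_of_ord a <> b by move=> h /val_inj.
have P := val_opred i.
rewrite /simple; case: tpermP => [->|->|/E h1 /E h2];
  case: tpermP => [->|->|/E h3 /E h4] lt_xy;
  by [right | left; move: lt_xy; lia].
Qed.

Lemma inv_simple i w (a b : 'I_n.+1) : w a = i -> w b = opred i ->
  inversions (simple i \oc w) \subset (b, a) |: inversions w.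
Proof.
move=> wa wb; apply/subsetP=> -[x y]; rewrite !inE /= !permM => /andP[xy].
rewrite xy => /simple_lt[-> | [wy wx]]; first by rewrite orbT.
have -> : x = b by apply: (@perm_inj _ w); rewrite wx wb.
have -> : y = a by apply: (@perm_inj _ w); rewrite wy wa.
by rewrite eqxx.
Qed.

Lemma inv_word K : #|inversions (word_perm K)| <= size K.
Proof.
elim: K => [|i K IH] /=.
  rewrite leqn0 cards_eq0; apply/eqP/setP=> -[x y]; rewrite !inE /= !perm1; lia.
set w := word_perm K in IH *.
have h := @inv_simple i w ((w^-1)%g i) ((w^-1)%g (opred i)) (permKV _ _) (permKV _ _).
by apply: (leq_trans (subset_leq_card h)); rewrite cardsU1; lia.
Qed.

Lemma inv_simple_lt i w (a b : 'I_n.+1) : w a = i -> w b = opred i -> a < b ->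
  0 < i -> #|inversions (simple i \oc w)| < #|inversions w|.
Proof.
move=> wa wb ab i0; apply/proper_card/properP; split.
  apply/subsetP=> -[x y] h; have := subsetP (inv_simple wa wb) _ h.
  rewrite in_setU1 => /orP[/eqP[xb ya]|//]; move: h.
  by rewrite inE /= xb ya => /andP[]; lia.
exists (a, b); rewrite !inE /= ?permM ?wa ?wb ab /=.
  by rewrite val_opred; lia.
by rewrite tpermL tpermR val_opred; lia.
Qed.

Lemma peel m j w : j <= n -> (forall x : 'I_n.+1, x < j -> w x = x) ->
  w (inord j) = j + m :> nat ->
  exists K w', [/\ [seq val i | i <- K] = rev (iota j.+1 m),
    word_perm K \oc w' = w, size K + #|inversions w'| <= #|inversions w|
    & forall x : 'I_n.+1, x < j.+1 -> w' x = x].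
Proof.
elim: m w => [|m IH] w jn fixw wj.
  exists [::], w; split=> //; first by rewrite /compp mulg1.
  move=> x; rewrite ltnS leq_eqVlt => /orP[/eqP xj|/fixw//].
  have -> : x = inord j by apply: val_inj; rewrite /= inordK.
  by apply: val_inj; rewrite /= wj inordK ?addn0.
have lt_i : j + m.+1 < n.+1 by rewrite -wj.
pose i := Ordinal lt_i.
have wji : w (inord j) = i by apply: val_inj.
pose b := (w^-1)%g (opred i).
have wb : w b = opred i by rewrite permKV.
have oi : opred i = j + m :> nat by rewrite val_opred /=; lia.
have jb : (inord j : 'I_n.+1) < b.
  rewrite inordK // ltnNge; apply/negP; rewrite leq_eqVlt => /orP[/eqP bj|bj].
    have bE : b = inord j by apply: val_inj; rewrite /= inordK.
    by have := congr1 val wb; rewrite bE wji /= oi; lia.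
  by have := congr1 val wb; rewrite fixw //= oi; lia.
have [||K [w' [KE Kw sz fx]]] := IH (simple i \oc w) jn.
- move=> x xj; rewrite permM fixw // tpermD //; apply/eqP => /(congr1 val) /=; lia.
- by rewrite permM wji tpermR oi.
have revE : rev (iota j.+1 m.+1) = j + m.+1 :: rev (iota j.+1 m).
  by rewrite -(addn1 m) iotaD rev_cat /= addn1 addSnnS.
exists (i :: K), w'; split=> //.
- by rewrite revE -KE.
- have -> : w = simple i \oc (simple i \oc w).
    by rewrite /compp -mulgA tperm2 mulg1.
  by rewrite -Kw /compp mulgA.
- have i0 : 0 < i by rewrite /= addnS.
  by have := inv_simple_lt wji wb jb i0; move: sz => /=; lia.
Qed.

Lemma canon d j w : j + d = n -> (forall x : 'I_n.+1, x < j -> w x = x) ->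
  exists B K, [/\ forall l, j < l <= n -> block l (B l),
    [seq val i | i <- K] = flatten [seq B l | l <- iota j.+1 d],
    word_perm K = w & size K <= #|inversions w|].
Proof.
elim: d j w => [|d IH] j w jd fixw.
  exists (fun=> [::]), [::]; split=> //=; first by move=> l _; left.
  apply/permP=> x; rewrite perm1; case: (ltnP x j) => [/fixw//|jx].
  have [xE|xE] : x = w x \/ w x < j.
    case: (ltnP (w x) j) => h; [by right | left; apply: val_inj].
    by have := ltn_ord x; have := ltn_ord (w x); rewrite /=; lia.
  - exact: xE.
  - by have /perm_inj wx := fixw _ xE; move: xE; rewrite wx; lia.
have jn : j <= n by lia.
have wj : j <= w (inord j).
  rewrite leqNgt; apply/negP => h; have /perm_inj wx := fixw _ h.
  by move: h; rewrite wx inordK // ltnn.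
have [K [w' [KE Kw sz fx]]] :=
  @peel (w (inord j) - j) j w jn fixw (esym (subnKC wj)).
have [|B [K' [bB K'E K'w sz']]] := IH j.+1 w' _ fx; first by lia.
exists (fun l => if l == j.+1 then [seq val i | i <- K] else B l), (K ++ K').
split.
- move=> l /andP[jl ln]; case: eqP => [->|/eqP ne]; last by apply: bB; lia.
  rewrite KE; case: (posnP (w (inord j) - j)) => [->|m0]; [by left | right].
  have := ltn_ord (w (inord j)) => wn.
  by exists (w (inord j)); [lia | congr (rev (iota _ _)); lia].
- rewrite map_cat K'E /= eqxx; congr (_ ++ flatten _).
  apply/eq_in_map => l; rewrite mem_iota => hl.
  by case: eqP => // ?; lia.
- rewrite -Kw -K'w; elim: (K) => [|i L IHL] /=; first by rewrite /compp mulg1.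
  by rewrite IHL /compp mulgA.
- by rewrite size_cat; lia.
Qed.

Lemma canonical_word w : exists K,
  [/\ block_word K, word_of K w & size K <= #|inversions w|].
Proof.
have [//|//|B [K [bB KE Kw sz]]] := @canon n 0 w.
exists K; split=> //; first by exists B.
rewrite /word_of Kw eqxx andbT; apply/negP => /(map_f val); rewrite KE.
case/flattenP=> s /mapP[j]; rewrite mem_iota => jn ->.
have hj : 0 < j <= n by lia.
by case: (bB j hj) => [->//|[k _ ->]]; rewrite mem_rev mem_iota /=; lia.
Qed.

Lemma word_of_exists w :
  exists r, [exists K : r.-tuple 'I_n.+1, word_of K w].
Proof.
have [K [_ Kw _]] := canonical_word w.
by exists (size K); apply/existsP; exists (in_tuple K).
Qed.

(* Coxeter length: least size of a word for w. *)
Definition len w : nat := ex_minn (word_of_exists w).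

Definition reduced_word K w : bool := word_of K w && (size K == len w).

(* I is the word I(v). *)
Definition is_I_of v I : Prop := reduced_word I v /\ block_word I.

Lemma is_I_of_exists v : exists I, is_I_of v I.
Proof.
have [K [bK Kv sz]] := canonical_word v; exists K; split=> //.
rewrite /reduced_word Kv /len; case: ex_minnP => m /existsP[L /andP[_ /eqP Lv]] mn.
rewrite eqn_leq (leq_trans sz) /=; last by rewrite -Lv -{2}(size_tuple L) inv_word.
by apply: mn; apply/existsP; exists (in_tuple K).
Qed.

(* A chain from u is given by its steps (i_1, j_1), ..., (i_m, j_m); the
   u_k are determined by u_k = u_(k-1) (i_k, j_k). *)
Notation chain := (seq ('I_n.+1 * 'I_n.+1)).

Fixpoint chain_from_to u v (g : chain) : bool :=
  if g is (i, j) :: g' then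
    let u' := u \oc tperm i j in
    [&& i < j, u i < u j, len u' == (len u).+1 & chain_from_to u' v g']
  else u == v.

Definition C0 u v : pred chain :=
  [pred g | chain_from_to u v g && sorted leq [seq val p.1 | p <- g]].

Definition Inv v : {set 'I_n.+1 * 'I_n.+1} :=
  [set (v p.2, v p.1) | p : 'I_n.+1 * 'I_n.+1 & (p.1 < p.2) && (v p.2 < v p.1)].

(* The pairs (u_(k-1) (i_k), v (i_k)). *)
Fixpoint chain_pairs u v (g : chain) : seq ('I_n.+1 * 'I_n.+1) :=
  if g is (i, j) :: g' then (u i, v i) :: chain_pairs (u \oc tperm i j) v g'
  else [::].

Definition subword J I : bool :=
  all2 (fun a b => (a == ord0) || (a == b)) J I.

Definition Rsub u I : pred (seq 'I_n.+1) :=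
  [pred J | subword J I && reduced_word [seq i <- J | i != ord0] u].

Definition del J p : seq 'I_n.+1 := set_nth ord0 J p ord0.

(* Delete the unique nonzero letter of J whose deletion yields a word for w
   (if there is no such unique letter, J is returned unchanged). *)
Definition del_to J w : seq 'I_n.+1 :=
  if [seq p <- iota 0 (size J) |
       (nth ord0 J p != ord0) && (word_perm (del J p) == w)] is [:: p]
  then del J p else J.

(* J_0, computed from J_m = I by J_(k-1) = del_to J_k u_(k-1). *)
Fixpoint F I u (g : chain) : seq 'I_n.+1 :=
  if g is (i, j) :: g' then del_to (F I (u \oc tperm i j) g') u else I.

Section Polynomials.
Variable R : comNzRingType.
Local Open Scope ring_scope.

Definition E u v (g : chain) : {mpoly R[n.+1]} :=
  \prod_(p in Inv v :\: [set:: chain_pairs u v g]) ('X_p.1 - 'X_p.2).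

Definition alpha i : {mpoly R[n.+1]} := 'X_(opred i) - 'X_i.

(* msym w is the ring morphism 'X_a |-> 'X_(w a), i.e. the action of w. *)
Definition SC J I : {mpoly R[n.+1]} :=
  \prod_(j < size I | nth ord0 J j != ord0)
     msym (word_perm (take j I)) (alpha (nth ord0 I j)).

End Polynomials.
End Words.

Arguments E {n} R u v g.
Arguments SC {n} R J I.

(* Main.v *)
Require Import Defs.
From mathcomp Require Import zify.

(** Write I = I(v) as a concatenation of blocks, where block i (0-based) consists
    of the letters k, k - 1, ..., i + 1 for some k = k_i >= i, and let A_i be the
    permutation of the blocks before i. Two facts about these blocks carry the
    proof. The later blocks fix the point i, and block i carries i to k_i, so
    v(i) = A_i(k_i). And A_i is increasing on the points >= i (blocks_mono).

    Consider a subword J whose blocks before i are intact and whose block i ends,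
    after its last deletion, in the intact run q, q - 1, ..., i + 1. The part of
    block i before this run fixes q, so the permutation of J has the value A_i(q)
    at i. Deleting the letter x + 1 of the run, i <= x < q, changes this value to
    A_i(x), and all smaller values at later positions are of the form A_i(x) with
    x < q. Hence the steps downwards at position i are exactly the deletions in
    that run (delete_step, restore_step). Reading a chain backwards, its
    positions weakly decrease, so F deletes letters block by block from the right,
    and inside a block from left to right; the letter deleted is the required one
    because deletions from a reduced word are determined by their effect
    (del_inj_lt).

    For the inverse, restore the deleted letters in the opposite order: first the
    last deletion in the first block that has one. Each restoration goes up in
    Bruhat order, so the length grows by at least one; it is bounded by the
    number of letters, which grows by one, so all the intermediate words are
    reduced (F_surj). The place of the letter to be restored depends on the
    subword only (slot_inj), which also gives injectivity (F_inj).

    For the weights, the root of the letter x + 1 of block i in I is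
    x_a - x_b with a = A_i(x) and b = A_i(k_i) = v(i); here a is the value at i
    after the deletion, so (a, b) is the pair (u_(k-1)(i_k), v(i_k)) of the chain
    step (root_fill). As the roots of the letters of I enumerate Inv(v) without
    repetition (Inv_roots), the product over the letters that remain is E. *)

Set Implicit Arguments.
Unset Strict Implicit.
Unset Printing Implicit Defensive.

Import GRing.Theory.

(** * Roots of a word, exchange and deletion *)

Section Words.
Variable n : nat.
Implicit Types (u v w : 'S_n.+1) (I J K T : seq 'I_n.+1).
Local Notation wp := (@word_perm n).
Local Notation z0 := (ord0 : 'I_n.+1).
Local Notation nz := (fun l : 'I_n.+1 => l != ord0).

Lemma word_perm_cat K1 K2 x : wp (K1 ++ K2) x = wp K1 (wp K2 x).
Proof. by elim: K1 => [|l K1 IH] /=; rewrite ?perm1 // !permM IH. Qed.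

Lemma word_perm_catM K1 K2 : wp (K1 ++ K2) = (wp K2 * wp K1)%g.
Proof. by apply/permP => x; rewrite permM word_perm_cat. Qed.

Lemma word_perm_cons l K : wp (l :: K) = (wp K * simple l)%g.
Proof. by []. Qed.

Lemma simple0 : simple z0 = 1%g.
Proof.
have op0 : opred z0 = z0 by apply: val_inj; rewrite /= val_opred.
by rewrite /simple op0 tperm1.
Qed.

Lemma word_perm_nz K : wp (filter nz K) = wp K.
Proof.
elim: K => //= l K IH; case: eqP => [->|_] /=; last by rewrite IH.
by rewrite IH simple0 /compp mulg1.
Qed.

Lemma lenE w : len w = #|inversions w|.
Proof.
have [K [_ Kw sz]] := canonical_word w.
rewrite /len; case: ex_minnP => m /existsP[L /andP[_ /eqP Lw]] mn.
apply/eqP; rewrite eqn_leq (leq_trans _ sz) /=; last first.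
  by apply: mn; apply/existsP; exists (in_tuple K).
by rewrite -Lw -{2}(size_tuple L) inv_word.
Qed.

Lemma len_leq_count K : len (wp K) <= count nz K.
Proof. by rewrite lenE -word_perm_nz -size_filter inv_word. Qed.

Lemma reduced_wordE J u :
  reduced_word (filter nz J) u = (wp J == u) && (count nz J == len u).
Proof. by rewrite /reduced_word /word_of mem_filter eqxx word_perm_nz size_filter. Qed.

(** The root s_(i_1) ... s_(i_(p-1)) alpha_(i_p) of the letter at position p,
    as the pair (a, b) of indices of x_a - x_b. *)
Definition root K p : 'I_n.+1 * 'I_n.+1 :=
  let l := nth z0 K p in (wp (take p K) (opred l), wp (take p K) l).

(** Going from a word for w to one for s_l w creates at most one inversion, the
    one whose values are the two points that s_l exchanges; this is the root of
    the new first letter, and s_l acts on the roots of all the others. *)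
Lemma inversion_root K (a b : 'I_n.+1) : a < b -> wp K b < wp K a ->
  exists2 p, p < size K & root K p = (wp K b, wp K a).
Proof.
move=> ab; elim: K => [|l K IH] /=; first by rewrite !perm1; lia.
rewrite !permM => /simple_lt[/IH[p ps [<- <-]]|[-> ->]].
  by exists p.+1 => //; rewrite /root /= !permM.
by exists 0 => //; rewrite /root /= !perm1 /simple tpermL tpermR.
Qed.

Lemma del_cat X l W : del (X ++ l :: W) (size X) = X ++ z0 :: W.
Proof.
by rewrite /del set_nthE size_cat /= addnS ltnS leq_addr take_size_cat // drop_cat
  ltnNge leqnSn /= subSnn /= drop0.
Qed.

Lemma split_nth K p : p < size K -> exists X W,
  K = X ++ nth z0 K p :: W /\ p = size X.
Proof.
move=> ps; exists (take p K), (drop p.+1 K).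
by rewrite -drop_nth // cat_take_drop size_take ps.
Qed.

Lemma root_cat X l W : root (X ++ l :: W) (size X) = (wp X (opred l), wp X l).
Proof. by rewrite /root take_size_cat // nth_cat ltnn subnn. Qed.

(** Deleting a letter composes the permutation on the left with the reflection
    in the root of that letter; in the order of the group product this reflection
    is the right factor. *)
Lemma word_perm_del X l W : wp (X ++ z0 :: W) =
  (wp (X ++ l :: W) * tperm (wp X (opred l)) (wp X l))%g.
Proof.
rewrite !word_perm_catM /= /compp simple0 mulg1 -tpermJ -/(simple l) conjgE.
rewrite -!mulgA mulKVg; congr (_ * _)%g.
by rewrite mulgA [(simple l * _)%g]tperm2 mul1g.
Qed.

Lemma tperm_comp u i j : compp u (tperm i j) = (u * tperm (u i) (u j))%g.
Proof. by rewrite /compp -tpermJ conjgE !mulgA mulgV mul1g. Qed.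

Lemma count_zero X l W : l != z0 ->
  count nz (X ++ l :: W) = (count nz (X ++ z0 :: W)).+1.
Proof. by move=> l0; rewrite !count_cat /= l0 addnS. Qed.

(** The strong exchange property: the inversion (i, j) of the larger permutation
    is the root of some letter of a word of minimal size, and deleting that
    letter leaves a word for u. *)
Lemma len_tperm u (i j : 'I_n.+1) : i < j -> u i < u j ->
  len u < len (compp u (tperm i j)).
Proof.
set w := compp _ _ => ij uij.
have wi : w i = u j by rewrite permM tpermL.
have wj : w j = u i by rewrite permM tpermR.
have [K [_ /andP[K0 /eqP Kw] sz]] := canonical_word w.
have [|p ps] := @inversion_root K _ _ ij; first by rewrite Kw wi wj.
have [X [W [KE pX]]] := split_nth ps.
move: KE pX; set l := nth _ _ _ => KE ->.
rewrite {1}KE root_cat Kw wi wj => -[Xl Xr].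
have l0 : l != z0 by apply: contraNneq K0 => <-; apply: mem_nth.
have -> : u = wp (X ++ z0 :: W).
  rewrite (word_perm_del _ l) -KE Kw Xl Xr /w tperm_comp -mulgA.
  by rewrite tperm2 mulg1.
apply: leq_ltn_trans (len_leq_count _) _.
by rewrite -(count_zero _ _ l0) -KE lenE (leq_trans _ sz) // count_size.
Qed.

Lemma del_del_word_perm X a M b W :
  wp (X ++ z0 :: M ++ b :: W) = wp (X ++ a :: M ++ z0 :: W) ->
  wp (X ++ a :: M ++ b :: W) = wp (X ++ z0 :: M ++ z0 :: W).
Proof.
rewrite !(word_perm_catM, word_perm_cons) simple0 !mulg1.
by move=> /mulIg ->; rewrite -(mulgA _ (simple a) (simple a)) [(simple a * _)%g]tperm2 mulg1.
Qed.

(** If two deletions had the same effect, deleting both letters would not change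
    the permutation either, so the word would not be reduced. *)
Lemma del_inj_lt K p q : count nz K = len (wp K) -> p < q < size K ->
  nth z0 K p != z0 -> nth z0 K q != z0 -> wp (del K p) != wp (del K q).
Proof.
move=> cK /andP[pq qs] p0 q0; have ps := ltn_trans pq qs.
have [X [W' [KE pX]]] := split_nth ps.
have q's : q - p.+1 < size W'.
  by move: qs; rewrite KE size_cat /= -pX; lia.
have [M [W [W'E qM]]] := split_nth q's.
have bE : nth z0 W' (q - p.+1) = nth z0 K q.
  rewrite KE nth_cat -pX ltnNge (ltnW pq) /= -(subnSK pq) //.
rewrite bE in W'E; apply/eqP => /esym.
move: KE; rewrite W'E; move: (nth _ K p) (nth _ K q) p0 q0 => a b a0 b0 KE.
have -> : del K p = X ++ z0 :: M ++ b :: W by rewrite KE pX del_cat.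
have -> : del K q = X ++ a :: M ++ z0 :: W.
  have -> : q = size (X ++ a :: M) by rewrite size_cat /= -pX -qM; lia.
  by rewrite KE -!cat_cons !catA del_cat.
move=> /esym/del_del_word_perm; rewrite -KE => KK.
have := len_leq_count (X ++ z0 :: M ++ z0 :: W).
rewrite -KK -cK KE !count_cat /= !count_cat /= a0 b0; lia.
Qed.

Lemma del_to_cat X l W u : l != z0 ->
  count nz (X ++ l :: W) = len (wp (X ++ l :: W)) -> wp (X ++ z0 :: W) = u ->
  del_to (X ++ l :: W) u = X ++ z0 :: W.
Proof.
move=> l0 red uE; rewrite /del_to; set K := X ++ _.
have szX : size X < size K by rewrite size_cat /= -addSnnS leq_addr.
have nX : nth z0 K (size X) = l by rewrite nth_cat ltnn subnn.
have dX : wp (del K (size X)) = u by rewrite del_cat.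
rewrite (_ : [seq _ <- _ | _] = [:: size X]) ?del_cat //.
rewrite -(@filter_pred1_uniq _ (iota 0 (size K))) ?iota_uniq ?mem_iota //.
apply/eq_in_filter => p; rewrite mem_iota add0n => /= ps.
apply/idP/eqP => [/andP[p0 /eqP pu]|->]; last by rewrite nX l0 dX eqxx.
case: (ltngtP p (size X)) => // pX.
- have pq : p < size X < size K by rewrite pX.
  by have := del_inj_lt red pq p0; rewrite nX dX pu eqxx => /(_ l0).
- have pq : size X < p < size K by rewrite pX.
  by have := del_inj_lt red pq; rewrite nX dX pu eqxx => /(_ l0 p0).
Qed.

(** Every inversion is a root, and a reduced word has exactly as many letters as
    there are inversions, so the enumeration of the inversions by the roots is
    onto, hence bijective. *)
Lemma Inv_roots v I : reduced_word I v ->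
  Inv v = [set root I p | p : 'I_(size I)] /\ injective (fun p : 'I_(size I) => root I p).
Proof.
rewrite /reduced_word /word_of => /andP[/andP[_ /eqP Iv] /eqP sz].
have cInv : #|Inv v| = size I.
  rewrite sz lenE /Inv card_imset //.
  by move=> [a b] [c d] /= [/perm_inj -> /perm_inj ->].
have sub : Inv v \subset [set root I p | p : 'I_(size I)].
  apply/subsetP => _ /imsetP[[a b] + ->]; rewrite inE /= -Iv => /andP[ab vab].
  have [p ps rp] := inversion_root ab vab.
  by apply/imsetP; exists (Ordinal ps); rewrite /= ?rp.
have le : #|[set root I p | p : 'I_(size I)]| <= size I.
  by rewrite (leq_trans (leq_imset_card _ _)) // card_ord.
have E : Inv v = [set root I p | p : 'I_(size I)].
  by apply/eqP; rewrite eqEcard sub cInv.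
split=> //; have /imset_injP inj : #|[set root I p | p : 'I_(size I)]| == #|'I_(size I)|.
  by rewrite -E cInv card_ord.
by move=> p q; apply: inj.
Qed.

Lemma SC_root (R : comNzRingType) J I : SC R J I =
  (\prod_(j < size I | nth ord0 J j != ord0) ('X_(root I j).1 - 'X_(root I j).2))%R.
Proof.
apply: eq_bigr => j _; rewrite /alpha /root /= rmorphB /= !msymX.
have e w (a : 'I_n.+1) :
    [multinom [tuple (U_(a))%MM (w^-1%g i) : nat | i < n.+1]] = (U_(w a))%MM.
  apply/mnmP => i; rewrite mnmE !mnm1E; congr nat_of_bool.
  by rewrite -(inj_eq (@perm_inj _ w)) permKV.
by rewrite !e.
Qed.

(** Since the roots of the letters of I enumerate Inv v without repetition, SC
    and E agree as soon as the chain pairs are the roots of the deleted letters. *)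
Lemma SC_eq_E (R : comNzRingType) J u v g I : reduced_word I v ->
  (forall q, q \in chain_pairs u v g <->
     exists p, [/\ p < size I, nth z0 J p = z0 & root I p = q]) ->
  SC R J I = E R u v g.
Proof.
move=> rI pairs; rewrite SC_root /E; have [-> inj] := Inv_roots rI.
rewrite -(@big_imset _ _ _ _ _ (fun p : 'I_(size I) => root I p)
  [pred j : 'I__ | nth z0 J j != z0] (fun q => 'X_q.1 - 'X_q.2)%R) /=; last first.
  by move=> p q _ _; apply: inj.
apply: eq_bigl => q; rewrite !inE; apply/imsetP/andP.
  case=> p; rewrite inE => p0 ->; split; last by apply/imsetP; exists p.
  apply: contraNN p0 => /pairs[r [rs r0 rp]].
  by have := inj (Ordinal rs) p rp => <-; rewrite r0.
case=> nq /imsetP[p _ qp]; exists p => //; rewrite inE; apply: contraNN nq => /eqP p0.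
by apply/pairs; exists p.
Qed.

End Words.

(** * Subwords of decreasing runs *)

Section Runs.
Variable n : nat.
Implicit Types (u v w : 'S_n.+1) (I J K T Z : seq 'I_n.+1).
Local Notation wp := (@word_perm n).
Local Notation z0 := (ord0 : 'I_n.+1).

Lemma subword_size J I : subword J I -> size J = size I.
Proof. by elim: I J => [|b I IH] [|a J] //= /andP[_ /IH->]. Qed.

Lemma subword_refl I : subword I I.
Proof. by elim: I => //= a I ->; rewrite eqxx orbT. Qed.

Lemma subword_cat J1 J2 I1 I2 : size J1 = size I1 ->
  subword (J1 ++ J2) (I1 ++ I2) = subword J1 I1 && subword J2 I2.
Proof.
by elim: I1 J1 => [|b I1 IH] [|a J1] //= [/IH e]; rewrite /subword /= -!/(subword _ _) e andbA.
Qed.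

Lemma subword_catP J I1 I2 : subword J (I1 ++ I2) ->
  exists J1 J2, [/\ J = J1 ++ J2, subword J1 I1 & subword J2 I2].
Proof.
move=> sJ; have sz := subword_size sJ; exists (take (size I1) J), (drop (size I1) J).
have sz1 : size (take (size I1) J) = size I1.
  by rewrite size_takel // sz size_cat leq_addr.
by move: sJ; rewrite -{1}(cat_take_drop (size I1) J) subword_cat // cat_take_drop => /andP[].
Qed.

Lemma subword_no_zero J I : subword J I -> ord0 \notin J -> J = I.
Proof.
elim: I J => [|b I IH] [|a J] //= /andP[ab /IH{}IH]; rewrite inE negb_or => /andP[a0 /IH->].
by move: ab; rewrite eq_sym (negbTE a0) => /eqP->.
Qed.

(** Words of this kind, deleted letters included, fix the points below c. *)
Definition above (c : nat) K := all (fun l : 'I_n.+1 => (l == ord0) || (c < l)) K.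

Lemma above_subword c J I : subword J I -> above c I -> above c J.
Proof.
elim: I J => [|b I IH] [|a J] //= /andP[/orP[]/eqP-> /IH{}IH] /andP[h /IH->];
  by rewrite ?h ?eqxx.
Qed.

Lemma above_fix c K (x : 'I_n.+1) : above c K -> x < c -> wp K x = x.
Proof.
move=> aK xc; elim: K aK => [|l K IH] /=; first by rewrite perm1.
move=> /andP[/orP[/eqP->|cl] /IH E]; rewrite permM E ?simple0 ?perm1 //.
by rewrite tpermD //; apply/eqP => /(congr1 val) /=; rewrite ?val_opred; lia.
Qed.

Lemma above_ge c K (x : 'I_n.+1) : above c K -> c <= x -> c <= wp K x.
Proof.
move=> aK cx; rewrite leqNgt; apply/negP => h.
by have /perm_inj e := above_fix aK h; move: h; rewrite e ltnNge cx.
Qed.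

(** A block of I(v), written with its 0-based position i and the point q to which
    it carries i, so that the empty block is the case q = i. *)
Definition run i q : seq 'I_n.+1 := [seq inord l | l <- rev (iota i.+1 (q - i))].

Lemma run_nil i : run i i = [::].
Proof. by rewrite /run subnn. Qed.

Lemma run_cons i q : i <= q -> run i q.+1 = inord q.+1 :: run i q.
Proof.
by move=> iq; rewrite /run subSn // -[(q - i).+1]addn1 iotaD rev_cat /= addSn subnKC.
Qed.

Lemma size_run i q : size (run i q) = q - i.
Proof. by rewrite size_map size_rev size_iota. Qed.

Lemma run_cat i x q : i <= x <= q -> run i q = run x q ++ run i x.
Proof.
move=> /andP[ix]; elim: q => [|q IH].
  by rewrite leqn0 => /eqP->; rewrite run_nil.
rewrite leq_eqVlt => /orP[/eqP<-|xq]; first by rewrite run_nil.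
by rewrite !run_cons ?IH //; lia.
Qed.

Lemma run_split i x q : i <= x < q ->
  run i q = run x.+1 q ++ inord x.+1 :: run i x.
Proof.
by move=> /andP[ix xq]; rewrite (@run_cat i x.+1) ?run_cons //; lia.
Qed.

Lemma above_run c i q : q <= n -> c <= i -> above c (run i q).
Proof.
move=> qn ci; apply/allP => l /mapP[y]; rewrite mem_rev mem_iota => yi ->.
by apply/orP; right; rewrite inordK; lia.
Qed.

Lemma run_nz i q : q <= n -> z0 \notin run i q.
Proof.
move=> qn; apply/negP => /mapP[y]; rewrite mem_rev mem_iota => yi /(congr1 val) /=.
by rewrite inordK; lia.
Qed.

Lemma run_perm i q (x : 'I_n.+1) : i <= q <= n ->
  wp (run i q) x = (if x == i :> nat then q else if i < x <= q then x.-1 else x) :> nat.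
Proof.
elim: q => [|q IH] iq.
  have -> : i = 0 by lia.
  by rewrite run_nil perm1; case: eqP => [->|] //; case: ifP; lia.
case: (leqP i q) => [iq'|qi]; last first.
  have -> : i = q.+1 by lia.
  rewrite run_nil perm1; case: eqP => //; case: ifP; lia.
rewrite run_cons // word_perm_cons permM.
have {}IH := IH ltac:(lia).
set y := wp (run i q) x in IH *.
have e : (inord q.+1 : 'I_n.+1) = q.+1 :> nat by rewrite inordK; lia.
have eo : opred (inord q.+1 : 'I_n.+1) = q :> nat by rewrite val_opred e.
rewrite /simple; case: tpermP => [h|h|/eqP h1 /eqP h2].
- have := congr1 val h; rewrite /= eo e IH; repeat case: ifP; lia.
- have := congr1 val h; rewrite /= eo e IH; repeat case: ifP; lia.
- move: h1 h2; rewrite -!val_eqE /= eo e IH.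
  repeat case: ifP; lia.
Qed.

(** What follows the last deleted letter is an intact run i q; that letter being
    q + 1, all the letters that survive before it exceed q + 1. So T fixes q, and
    the subword carries i to q whatever T is. *)
Lemma subword_run i k J : i <= k <= n -> subword J (run i k) ->
  exists q T, [/\ i <= q <= k, J = T ++ run i q, subword T (run q k)
    & above q.+1 T].
Proof.
elim: k J => [|k IH] J ik.
  have -> : i = 0 by lia.
  by case: J => //; exists 0, [::].
case: (leqP i k) => [ik'|ki]; last first.
  have -> : i = k.+1 by lia.
  by rewrite run_nil; case: J => //; exists k.+1, [::]; rewrite run_nil leqnn.
rewrite run_cons //; case: J => // a J /andP[a0 sJ].
have [q [T [iq JE sT aT]]] := IH J ltac:(lia) sJ.
case: (eqVneq q k) => [qk|qk].
  move: sT JE; rewrite qk run_nil; case: T {aT} => // _ ->.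
  case/orP: a0 => /eqP->.
    exists k, [:: z0]; rewrite run_cons // run_nil.
    by split; rewrite ?/above /= ?eqxx ?ik' ?leqnSn.
  by exists k.+1, [::]; rewrite run_nil run_cons // leqnn; split=> //; lia.
exists q, (a :: T); rewrite run_cons; last by lia.
split; rewrite /subword /= -?/(subword _ _) ?a0 ?aT ?JE //; first by lia.
case/orP: a0 => /eqP-> //; rewrite inordK ?orbT //; first by apply/andP; split; lia.
by lia.
Qed.

End Runs.

(** * Deleting one letter of a block word *)

Section Blocks.
Variables (n : nat) (k : nat -> nat).
Hypothesis hk : forall i, i < n -> i <= k i <= n.
Implicit Types (u v w : 'S_n.+1) (J K T Z R : seq 'I_n.+1).
Local Notation wp := (@word_perm n).
Local Notation z0 := (ord0 : 'I_n.+1).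

(** Counting blocks from 0, block i carries the position i to k i; an empty block
    is encoded by k i = i. *)
Definition blocks a m : seq 'I_n.+1 := flatten [seq run n l (k l) | l <- iota a m].
Local Notation A := (blocks 0).
Local Notation Y i := (blocks i.+1 (n - i.+1)).
Local Notation I := (A n).

Lemma blocks_cat a m1 m2 : blocks a (m1 + m2) = blocks a m1 ++ blocks (a + m1) m2.
Proof. by rewrite /blocks iotaD map_cat flatten_cat. Qed.

Lemma blocks_cons a m : blocks a m.+1 = run n a (k a) ++ blocks a.+1 m.
Proof. by []. Qed.

Lemma blocks_rcons i : A i.+1 = A i ++ run n i (k i).
Proof. by rewrite -[i.+1]addn1 blocks_cat add0n blocks_cons cats0. Qed.

Lemma blocks_split i : i < n -> I = A i ++ run n i (k i) ++ Y i.
Proof. by move=> i_n; rewrite catA -blocks_rcons -blocks_cat subnKC. Qed.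

Lemma blocks_prefix i j : i < j -> exists W, A j = A i ++ run n i (k i) ++ W.
Proof.
move=> ij; exists (blocks i.+1 (j - i.+1)).
by rewrite catA -blocks_rcons -blocks_cat subnKC.
Qed.

Lemma blocks_nz i : i <= n -> z0 \notin A i.
Proof.
elim: i => // i IH i_n; rewrite blocks_rcons mem_cat negb_or IH ?(ltnW i_n) //=.
by apply: run_nz; case/andP: (hk i_n).
Qed.

Lemma above_blocks c a m : a + m <= n -> c <= a -> above c (blocks a m).
Proof.
elim: m a => // m IH a am ca; rewrite blocks_cons /above all_cat -!/(above _ _).
by rewrite above_run ?IH //; [lia..| by case/andP: (@hk a ltac:(lia))].
Qed.

(** A block i moves position i away and shifts the others down without changing
    their order, so the first i blocks preserve the order of the points that
    start at or beyond i. *)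
Lemma blocks_mono i (x y : 'I_n.+1) : i <= n -> i <= x -> x < y -> wp (A i) x < wp (A i) y.
Proof.
elim: i x y => [|i IH] x y i_n ix xy; first by rewrite !perm1.
rewrite blocks_rcons !word_perm_cat; have hi := hk i_n.
have := run_perm x hi; have := run_perm y hi.
move: (wp (run n i (k i)) x) (wp (run n i (k i)) y) => a b hb ha.
by apply: IH; [lia| move: hb ha; repeat case: ifP; lia..].
Qed.

Lemma blocks_tail (i : 'I_n.+1) Z : i < n -> subword Z (Y i) -> above i.+1 Z.
Proof. by move=> i_n /above_subword; apply; apply: above_blocks; lia. Qed.

Lemma blocks_start (i : 'I_n.+1) : i < n -> wp I i = wp (A i) (inord (k i)).
Proof.
move=> i_n; rewrite (blocks_split i_n) !word_perm_cat.
rewrite (@above_fix _ i.+1 (Y i)) ?(blocks_tail i_n) ?subword_refl //.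
congr (wp _ _); apply: val_inj; have hi := hk i_n; rewrite /= run_perm // eqxx inordK //; lia.
Qed.

(** With the letter x + 1 deleted and the rest of block i after it intact, the
    value at i is A i (x), because T fixes x. The letter x + 1 exchanges the
    values A i (x) and A i (T (x + 1)); as T (x + 1) >= x + 1 and A i is
    increasing there, restoring it is a step upwards. *)
Lemma restore_step (i : 'I_n.+1) x T Z : i < n -> i <= x < k i ->
  subword T (run n x.+1 (k i)) -> subword Z (Y i) ->
  let J := A i ++ T ++ z0 :: run n i x ++ Z in
  exists j : 'I_n.+1, [/\ i < j, wp J i < wp J j, wp J i = wp (A i) (inord x) &
    wp (A i ++ T ++ inord x.+1 :: run n i x ++ Z) = compp (wp J) (tperm i j)].
Proof.
move=> i_n ix sT sZ J; have hi := hk i_n.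
set l : 'I_n.+1 := inord x.+1.
have lE : l = x.+1 :> nat by rewrite inordK; lia.
have olE : opred l = inord x by apply: val_inj; rewrite /= val_opred lE inordK //=; lia.
have xE : (inord x : 'I_n.+1) = x :> nat by rewrite inordK; lia.
have aT : above x.+1 T by apply: above_subword sT (above_run _ _); lia.
have aW : above i (run n i x ++ Z).
  rewrite /above all_cat -!/(above _ _) above_run //=; last by lia.
  by apply/sub_all: (blocks_tail i_n sZ) => y /orP[->//|yi]; apply/orP; right; lia.
set W := run n i x ++ Z in aW *.
have Wi : wp W i = inord x.
  apply: val_inj; rewrite /W word_perm_cat (@above_fix _ i.+1 Z) ?(blocks_tail i_n) //=.
  by rewrite run_perm ?eqxx ?xE //; lia.
(* The other position whose value changes is the one that W sends to x + 1. *)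
pose j := ((wp W)^-1)%g l.
have Wj : wp W j = l by rewrite permKV.
have ij : i < j.
  rewrite ltn_neqAle; apply/andP; split.
    apply/eqP => /val_inj ij; move: Wj; rewrite -ij Wi => /(congr1 val) /=.
    by rewrite xE lE; lia.
  rewrite leqNgt; apply/negP => ji.
  by move: (above_fix aW ji); rewrite Wj => /(congr1 val) /=; lia.
have JE y : wp J y = wp (A i) (wp T (wp W y)).
  by rewrite /J -/W 2!word_perm_cat word_perm_cons permM simple0 perm1.
have Ji : wp J i = wp (A i) (inord x) by rewrite JE Wi (above_fix aT) // xE.
exists j; split=> //.
  rewrite Ji JE Wj; apply: blocks_mono; [lia|lia|].
  by rewrite xE; apply: (above_ge aT); rewrite lE.
rewrite tperm_comp JE Wi JE Wj -!(word_perm_cat (A i)) -olE /J !(catA (A i)).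
by rewrite (word_perm_del _ l) -mulgA tperm2 mulg1.
Qed.

(** Suppose all blocks before i are intact and block i ends in the intact run
    i q, so that the value at i is A i (q). Any smaller value A i (y) found at a
    later position has y < q by monotonicity of A i: hence the letter y + 1 lies
    in the intact run, and deleting it is the required step downwards. *)
Lemma delete_step (i j : 'I_n.+1) R : i < n -> i < j ->
  subword R (run n i (k i) ++ Y i) -> wp (A i ++ R) j < wp (A i ++ R) i ->
  exists x T Z, [/\ i <= x < k i, subword T (run n x.+1 (k i)), subword Z (Y i),
    R = T ++ inord x.+1 :: run n i x ++ Z &
    wp (A i ++ T ++ z0 :: run n i x ++ Z) = compp (wp (A i ++ R)) (tperm i j)].
Proof.
move=> i_n ij sR lt; have hi := hk i_n.
have aR : above i R.
  apply: above_subword sR _; rewrite /above all_cat -!/(above _ _).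
  by rewrite above_run ?above_blocks //; lia.
have [R1 [Z [RE sR1 sZ]]] := subword_catP sR.
have [q [T [iq R1E sT aT]]] := subword_run hi sR1.
have qE : (inord q : 'I_n.+1) = q :> nat by rewrite inordK; lia.
have Ri : wp R i = inord q.
  rewrite RE R1E !word_perm_cat (@above_fix _ i.+1 Z) ?(blocks_tail i_n) //.
  have -> : wp (run n i q) i = inord q.
    by apply: val_inj; rewrite /= run_perm ?eqxx ?qE //; lia.
  by rewrite (above_fix aT) // qE.
set y := wp R j.
have iy : i <= y by apply: above_ge; rewrite // ltnW.
have yq : y < q.
  rewrite ltnNge leq_eqVlt; apply/negP => /orP[/eqP qy|qy].
    have : y = wp R i by apply: val_inj; rewrite Ri /= qE.
    by move/perm_inj => ji; move: ij; rewrite ji ltnn.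
  move: lt; rewrite !word_perm_cat -/y Ri ltnNge ltnW // blocks_mono ?qE //; lia.
have RE' : R = (T ++ run n y.+1 q) ++ inord y.+1 :: run n i y ++ Z.
  by rewrite RE R1E (@run_split _ i y q) -?catA //; lia.
exists y, (T ++ run n y.+1 q), Z.
have sT' : subword (T ++ run n y.+1 q) (run n y.+1 (k i)).
  rewrite (@run_cat _ y.+1 q (k i)); last by lia.
  by rewrite subword_cat ?(subword_size sT) // sT subword_refl.
have iy' : i <= y < k i by lia.
split=> //.
have [j' [ij' _ Ji RJ]] := restore_step i_n iy' sT' sZ.
rewrite -RE' in RJ; set J := wp (_ ++ _) in Ji RJ *.
(* The position found by restore_step is j, since it also holds the value A i y. *)
have -> : j = j'.
  have Rj' : wp (A i ++ R) j' = J i by rewrite RJ permM tpermR.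
  apply: (@perm_inj _ (wp (A i ++ R))); rewrite Rj' Ji.
  by rewrite word_perm_cat -/y; congr (wp _ _); apply: val_inj; rewrite /= inordK.
by rewrite RJ /compp mulgA tperm2 mul1g.
Qed.

(** A place for the letter x + 1 in block i of a subword whose blocks before i
    are intact, as is the part of block i to the right of this place; T is what
    is left of the part of block i before it, Z of the later blocks. *)
Definition slot i x T Z : Prop := [/\ i < n, i <= x < k i,
  subword T (run n x.+1 (k i)) & subword Z (Y i)].

Definition fill i x T Z l : seq 'I_n.+1 := A i ++ T ++ l :: run n i x ++ Z.

Lemma slot_block i x T Z l : slot i x T Z ->
  size (T ++ l :: run n i x) = size (run n i (k i)).
Proof.
move=> [i_n ix sT _].
rewrite size_cat /= (subword_size sT) !size_run; lia.
Qed.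

Lemma fillE i x T Z l : fill i x T Z l = A i ++ (T ++ l :: run n i x) ++ Z.
Proof. by rewrite /fill -!catA. Qed.

Lemma fill_subword i x T Z l : slot i x T Z -> l = z0 \/ l = inord x.+1 ->
  subword (fill i x T Z l) I.
Proof.
move=> [i_n ix sT sZ] hl; rewrite (blocks_split i_n) (run_split n ix) -catA.
rewrite /fill subword_cat // subword_refl /= subword_cat ?(subword_size sT) // sT /=.
rewrite /subword /= -/(subword _ _) subword_cat // subword_refl sZ.
by case: hl => ->; rewrite ?eqxx ?orbT.
Qed.

Lemma fill_prefix i i' x T Z l : i < i' ->
  exists W, fill i' x T Z l = A i ++ run n i (k i) ++ W.
Proof. by move=> /blocks_prefix[W AE]; rewrite /fill AE -!catA; eexists. Qed.

(** A deletion in block i is incompatible with an intact block i: the blocks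
    contain no zero. *)
Lemma fill0_no_prefix i x T Z W : slot i x T Z ->
  fill i x T Z z0 <> A i ++ run n i (k i) ++ W.
Proof.
move=> s; rewrite fillE => /eqP; rewrite eqseq_cat // eqxx /=.
rewrite eqseq_cat ?(slot_block _ s) // => /andP[/eqP E _].
have [i_n _ _ _] := s; have /andP[_ kn] := hk i_n.
by have /negP[] := run_nz i kn; rewrite -E mem_cat inE eqxx orbT.
Qed.

Lemma slot_x_leq i x x' T T' Z Z' : slot i x T Z -> slot i x' T' Z' ->
  fill i x T Z z0 = fill i x' T' Z' z0 -> x' <= x.
Proof.
move=> s s' /eqP; rewrite !fillE eqseq_cat // eqxx /=.
rewrite eqseq_cat ?(slot_block _ s) ?(slot_block _ s') // => /andP[/eqP E _].
rewrite leqNgt; apply/negP => xx.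
have [i_n ix sT _] := s; have [_ ix' sT' _] := s'; have /andP[_ kn] := hk i_n.
have := congr1 (fun s => nth z0 s (size T)) E.
rewrite !nth_cat ltnn subnn /= (subword_size sT) (subword_size sT') !size_run.
rewrite ifN; last by lia.
have -> : k i - x.+1 - (k i - x'.+1) = (x' - x.+1).+1 by lia.
move=> /= E0; have /negP[] := @run_nz n i x' ltac:(lia).
by rewrite E0 mem_nth // size_run; lia.
Qed.

(** The slot of a deleted letter is determined by the subword: its block is the
    first one with a deletion, and it is the last deletion in that block. *)
Lemma slot_inj i i' x x' T T' Z Z' : slot i x T Z -> slot i' x' T' Z' ->
  fill i x T Z z0 = fill i' x' T' Z' z0 -> [/\ i = i', x = x', T = T' & Z = Z'].
Proof.
move=> s s' E.
have ii : i = i'.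
  case: (ltngtP i i') => // ii.
    have [W] := fill_prefix x' T' Z' z0 ii.
    by rewrite -E => /(fill0_no_prefix s).
  have [W] := fill_prefix x T Z z0 ii.
  by rewrite E => /(fill0_no_prefix s').
subst i'.
have xx : x = x'.
  by apply/eqP; rewrite eqn_leq (slot_x_leq s' s) ?(slot_x_leq s s').
subst x'; move/eqP: E; rewrite /fill eqseq_cat // eqxx /=.
have [_ _ /subword_size sT _] := s; have [_ _ /subword_size sT' _] := s'.
by rewrite eqseq_cat ?sT ?sT' // eqseq_cons eqseq_cat // !eqxx /= => /andP[/eqP-> /eqP->].
Qed.

(** Scan the blocks from the left up to the first one that has a deletion, and
    take the last deletion in it. *)
Lemma first_slot J : subword J I -> z0 \in J ->
  exists i x T Z, slot i x T Z /\ J = fill i x T Z z0.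
Proof.
move=> sJ J0.
suff H m : m <= n -> (exists i x T Z, slot i x T Z /\ J = fill i x T Z z0) \/
    exists2 J', J = A m ++ J' & subword J' (blocks m (n - m)).
  case: (H n (leqnn n)) => // -[J']; rewrite subnn; case: J' => // JE _.
  by move: J0; rewrite JE cats0 (negbTE (blocks_nz _)).
elim: m => [|m IH] mn; first by right; exists J; rewrite ?subn0.
case: (IH (ltnW mn)) => [|[J' JE]]; first by left.
have hm := hk mn.
rewrite -(subnSK mn) blocks_cons => /subword_catP[R [Z [J'E sR sZ]]].
have [q [T [mq RE sT aT]]] := subword_run hm sR.
case: (posnP (k m - q)) => [kq|qk].
  right; exists Z; rewrite // blocks_rcons -catA JE J'E RE.
  have <- : q = k m by lia.
  move: sT; have -> : q = k m by lia.
  by rewrite run_nil; case: (T).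
have qk' : q <= q < k m by lia.
move: sT; rewrite (run_split n qk') run_nil => /subword_catP[T1 [T2 [TE sT1 sT2]]].
case: T2 TE sT2 => [|a [|b T2]] TE; rewrite /subword /= ?andbF ?andbT // => ha.
left; exists m, q, T1, Z; split; first by split=> //; lia.
rewrite JE J'E RE TE /fill -!catA /=; congr (_ ++ _ ++ _ :: _).
move: aT; rewrite /above TE all_cat /= andbT => /andP[_].
case/orP: ha => /eqP-> //; rewrite inordK ?ltnn ?orbF; first by move/eqP.
lia.
Qed.
End Blocks.

(** * The map F on chains *)

Section Main.
Variables (n : nat) (k : nat -> nat).
Hypothesis hk : forall i, i < n -> i <= k i <= n.
Implicit Types (u v w : 'S_n.+1) (J K T Z R : seq 'I_n.+1) (g : seq ('I_n.+1 * 'I_n.+1)).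
Local Notation wp := (@word_perm n).
Local Notation z0 := (ord0 : 'I_n.+1).
Local Notation nz := (fun l : 'I_n.+1 => l != ord0).
Local Notation A := (blocks n k 0).
Local Notation Y i := (blocks n k i.+1 (n - i.+1)).
Local Notation I := (A n).
Local Notation slot := (@slot n k).
Local Notation fill := (@fill n k).
Hypothesis redI : reduced_word I (wp I).

Lemma RsubP J u : reflect [/\ subword J I, wp J = u & count nz J = len u] (J \in Rsub u I).
Proof.
rewrite inE /= reduced_wordE; apply: (iffP and3P) => [[-> /eqP-> /eqP->]|[-> -> ->]] //.
Qed.

Lemma full_word_nz : z0 \notin I.
Proof. by have /andP[/andP[]] := redI. Qed.

Lemma count_full_word : count nz I = len (wp I).
Proof.
have /andP[_ /eqP <-] := redI; apply/eqP; rewrite -all_count.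
by apply/allP => l lI; apply: contraNneq full_word_nz => <-.
Qed.

Lemma C0_nilP u v : ([::] \in C0 u v) = (u == v).
Proof. by rewrite inE /= andbT. Qed.

Lemma C0_consP u v (i j : 'I_n.+1) g : reflect
  [/\ i < j, u i < u j, len (compp u (tperm i j)) = (len u).+1,
      g \in C0 (compp u (tperm i j)) v
    & if g is (i', _) :: _ then i <= i' else true]
  ((i, j) :: g \in C0 u v).
Proof.
rewrite !inE /=; apply: (iffP andP).
  move=> [/and4P[-> -> /eqP-> ->] s]; rewrite (path_sorted s) andbT /=.
  by split=> //; case: g s => [|[i' j'] g] //= /andP[].
move=> [-> -> -> /andP[-> s] h]; rewrite eqxx; split=> //.
by case: g s h => [|[i' j'] g] //= -> ->.
Qed.

Lemma fill_reduced i x T Z u v : slot i x T Z ->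
  wp (fill i x T Z (inord x.+1)) = v -> count nz (fill i x T Z (inord x.+1)) = len v ->
  wp (fill i x T Z z0) = u ->
  count nz (fill i x T Z z0) = (len v).-1 /\
  del_to (fill i x T Z (inord x.+1)) u = fill i x T Z z0.
Proof.
move=> [i_n ix sT sZ] vE cv uE; have hi := hk i_n.
have l0 : (inord x.+1 : 'I_n.+1) != ord0 by rewrite -val_eqE /= inordK; lia.
move: vE cv uE; rewrite /fill !(catA (A i)) => vE cv uE.
split; first by rewrite -cv (count_zero _ _ l0).
by apply: del_to_cat; rewrite ?vE.
Qed.

(** The letters before x + 1 in I carry x to the value that u has at i, and
    x + 1 to the value that v has at i. This holds although the root is taken in
    I and not in the subword. *)
Lemma root_fill (i : 'I_n.+1) x T Z : slot i x T Z ->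
  root I (size (A i ++ T)) = (wp (fill i x T Z z0) i, wp I i).
Proof.
move=> [i_n ix sT sZ]; have hi := hk i_n.
have [j [_ _ Ji _]] := restore_step hk i_n ix sT sZ.
rewrite /fill Ji (blocks_start hk i_n) (blocks_split k i_n) (run_split n ix).
rewrite -catA catA /=.
have -> : size (A i ++ T) = size (A i ++ run n x.+1 (k i)).
  by rewrite !size_cat (subword_size sT).
rewrite root_cat !word_perm_cat; congr (wp _ _, wp _ _); apply: val_inj => /=.
  rewrite run_perm; last by lia.
  by rewrite val_opred !inordK; repeat case: ifP; lia.
rewrite run_perm; last by lia.
by rewrite !inordK ?eqxx; lia.
Qed.

(** The first step of a chain, at position i, corresponds to the last letter that
    F deletes: the invariant records that this letter sits at a slot of block i. *)
Definition starts_at_slot u g : Prop :=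
  if g is (i, j) :: g' then
    exists x T Z, [/\ slot i x T Z, F I u g = fill i x T Z z0
      & F I (compp u (tperm i j)) g' = fill i x T Z (inord x.+1)]
  else F I u g = I.

(** As the positions of a chain weakly increase, the deletions for the later
    steps all lie in blocks i and beyond, so delete_step applies to the first
    step. Uniqueness of the deleted letter identifies the result with F. *)
Lemma F_correct g u : g \in C0 u (wp I) -> F I u g \in Rsub u I /\ starts_at_slot u g.
Proof.
elim: g u => [|[i j] g IH] u.
  rewrite C0_nilP => /eqP->; split=> //; apply/RsubP; split=> //.
    exact: subword_refl.
  exact: count_full_word.
case/C0_consP=> ij uij lu gC si.
have [/RsubP[sR wR cR] hd] := IH _ gC.
set u' := compp _ _ in gC lu wR cR hd *; set R := F _ _ _ in sR wR cR hd.
have i_n : i < n by have := ltn_ord j; lia.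
have [R' RE] : exists R', R = A i ++ R'.
  rewrite /R; case: (g) si hd => [_ ->|[i' j'] g' /= ii [x [T [Z [_ -> _]]]]].
    by eexists; apply: blocks_split.
  move: ii; rewrite leq_eqVlt => /orP[/eqP->|ii]; first by eexists.
  by have [W ->] := fill_prefix k x T Z z0 ii; eexists.
have sR' : subword R' (run n i (k i) ++ Y i).
  by move: sR; rewrite RE {1}(blocks_split k i_n) subword_cat // => /andP[].
have lt : wp (A i ++ R') j < wp (A i ++ R') i.
  by rewrite -RE wR !permM tpermL tpermR.
have [x [T [Z [ix sT sZ R'E wJ]]]] := delete_step hk i_n ij sR' lt.
have s : slot i x T Z by [].
have RF : R = fill i x T Z (inord x.+1) by rewrite RE R'E.
have wJ' : wp (fill i x T Z z0) = u.
  by rewrite /fill wJ -RE wR /u' /compp mulgA tperm2 mul1g.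
rewrite RF in wR cR; have [cJ dJ] := fill_reduced s wR cR wJ'.
have FJ : F I u ((i, j) :: g) = fill i x T Z z0 by rewrite -dJ -RF.
split; last by exists x, T, Z.
rewrite FJ; apply/RsubP; split=> //; last by rewrite cJ lu.
by apply: fill_subword; [exact: s | left].
Qed.

Lemma F_pairs g u : g \in C0 u (wp I) -> forall q,
  q \in chain_pairs u (wp I) g <->
  exists p, [/\ p < size I, nth z0 (F I u g) p = z0 & root I p = q].
Proof.
elim: g u => [|[i j] g IH] u gC q.
  split=> // -[p [ps p0 _]]; have /negP[] := full_word_nz.
  by rewrite -p0 mem_nth.
have [_ [x [T [Z [s FJ FR]]]]] := F_correct gC.
have [/RsubP[sJ wJ _] _] := F_correct gC.
have ps : size (A i ++ T) < size I.
  by rewrite -(subword_size sJ) FJ /fill catA [X in _ < X]size_cat /= -addSnnS leq_addr.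
have rt := root_fill s; rewrite -FJ wJ in rt.
case/C0_consP: (gC) => _ _ _ /IH{}IH _.
have nthF l p : nth z0 (fill i x T Z l) p =
    if p == size (A i ++ T) then l else nth z0 (fill i x T Z z0) p.
  rewrite /fill !(catA (A i)) !(nth_cat _ _ (_ :: _)).
  case: (ltngtP p (size (A i ++ T))) => // [pT|->]; last by rewrite subnn.
  by rewrite -(subnSK pT).
rewrite [chain_pairs _ _ _]/= inE; split.
  case/orP=> [/eqP->|/IH[p [pI p0 <-]]].
    by exists (size (A i ++ T)); rewrite rt FJ nthF eqxx.
  exists p; split=> //; rewrite FR nthF in p0; rewrite FJ.
  by case: eqP p0 => // -> _; rewrite nthF eqxx.
case=> p [pI p0 <-]; case: (eqVneq p (size (A i ++ T))) => [->|pT].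
  by rewrite rt eqxx.
apply/orP; right; apply/IH; exists p; split=> //.
by rewrite FR nthF (negbTE pT) -FJ.
Qed.

(** The subword F I u g determines the slot of the last deleted letter, hence the
    position i, the preceding subword and the permutation u_1 that it spells;
    and u_1 = u (i, j) determines j. *)
Lemma F_inj g1 g2 u : g1 \in C0 u (wp I) -> g2 \in C0 u (wp I) ->
  F I u g1 = F I u g2 -> g1 = g2.
Proof.
have no_slot i x T Z : fill i x T Z z0 <> I.
  by move=> fI; have := full_word_nz; rewrite -fI /fill !mem_cat inE eqxx !orbT.
elim: g1 g2 u => [|[i j] g1 IH] [|[i' j'] g2] u // C1 C2 E.
- by have [_ [x [T [Z [_ FJ _]]]]] := F_correct C2; case: (no_slot i' x T Z); rewrite -FJ -E.
- by have [_ [x [T [Z [_ FJ _]]]]] := F_correct C1; case: (no_slot i x T Z); rewrite -FJ E.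
have [_ [x [T [Z [s FJ FR]]]]] := F_correct C1.
have [_ [x' [T' [Z' [s' FJ' FR']]]]] := F_correct C2.
rewrite FJ FJ' in E; have [/val_inj ii xx TT ZZ] := slot_inj hk s s' E.
subst i' x' T' Z'.
case/C0_consP: C1 => _ _ _ C1 _; case/C0_consP: C2 => _ _ _ C2 _.
have [/RsubP[_ w1 _] _] := F_correct C1; have [/RsubP[_ w2 _] _] := F_correct C2.
rewrite FR' -FR w1 in w2.
have jj : j = j'.
  apply: (@perm_inj _ u); have := congr1 (fun w : 'S_n.+1 => w i) w2.
  by rewrite /= !permM !tpermL.
by subst j'; rewrite (IH g2 _ C1 C2) // FR FR'.
Qed.

(** Restore the letter at the slot of J. The resulting word has one more letter
    and its permutation is larger than u, so both counts force it to be reduced,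
    and the restored step can be put in front of a chain for it. That chain
    starts at a position at least i, because no block before i has a deletion. *)
Lemma F_surj u J : J \in Rsub u I -> exists2 g, g \in C0 u (wp I) & F I u g = J.
Proof.
move: {2}(count_mem z0 J) (erefl (count_mem z0 J)) => m.
elim: m u J => [|m IH] u J cm /RsubP[sJ wJ cJ].
  have JI : J = I.
    by apply: (subword_no_zero sJ); apply/count_memPn.
  by exists [::]; rewrite ?C0_nilP -?wJ JI.
have J0 : z0 \in J by rewrite -has_pred1 has_count cm.
have [i0 [x [T [Z [s JE]]]]] := first_slot hk sJ J0.
have [i_n ix sT sZ] := s.
have [i iE] : exists i : 'I_n.+1, i = i0 :> nat by exists (Ordinal (leqW i_n)).
subst i0; have [j [ij uij _ RJ]] := restore_step hk i_n ix sT sZ.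
rewrite -/(fill i x T Z z0) -JE wJ in uij RJ; set u' := compp _ _ in RJ.
have hi := hk i_n.
have l0 : (inord x.+1 : 'I_n.+1) != ord0 by rewrite -val_eqE /= inordK; lia.
set R := fill i x T Z (inord x.+1).
have cR : count nz R = (count nz J).+1.
  by rewrite JE /R /fill !(catA (A i)) (count_zero _ _ l0).
have lu : len u' = (len u).+1.
  apply/eqP; rewrite eqn_leq (len_tperm ij uij) andbT -cJ -cR -RJ.
  exact: len_leq_count.
have RR : R \in Rsub u' I.
  apply/RsubP; split=> //; last by rewrite cR cJ lu.
  by apply: fill_subword; [exact: s | right].
have [|g gC Fg] := IH u' R _ RR.
  move: cm; rewrite JE /R /fill !count_cat /= (negbTE l0); lia.
exists ((i, j) :: g).
  apply/C0_consP; split=> //; case: g gC Fg => [|[i' j'] g] // gC Fg.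
  have [_ [x' [T' [Z' [s' FR _]]]]] := F_correct gC.
  rewrite leqNgt; apply/negP => /(fill_prefix k x T Z (inord x.+1))[W RW].
  by apply: (fill0_no_prefix hk s' (W := W)); rewrite -FR Fg.
have cu' : count nz R = len u' by rewrite cR cJ lu.
have [|_ dJ] := @fill_reduced _ _ _ _ u u' s RJ cu'; first by rewrite -JE.
by rewrite /= -/u' Fg dJ.
Qed.

End Main.

(** The value k i can be read off the size of the block of index i + 1. *)
Lemma block_word_runs n (I : seq 'I_n.+1) : block_word I ->
  exists2 k, (forall i, i < n -> i <= k i <= n) & I = blocks n k 0 n.
Proof.
case=> B bB IE; pose k i := i + size (B i.+1).
have BE i : i < n -> i <= k i <= n /\ B i.+1 = rev (iota i.+1 (k i - i)).
  move=> i_n; rewrite /k addKn; case: (bB i.+1) => [//|->|[m mi BE]].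
    by split=> //=; lia.
  rewrite BE size_rev size_iota subSS; split; last by [].
  by lia.
exists k => [i /BE[]//|]; apply: (inj_map val_inj).
rewrite IE /blocks map_flatten -!map_comp; congr flatten.
rewrite -[1]addn0 iotaDl -map_comp; apply/eq_in_map => i.
rewrite mem_iota => /= i_n; have [ik ->] := BE i i_n.
rewrite /run -map_comp -[LHS]map_id; apply/eq_in_map => l.
by rewrite mem_rev mem_iota => hl; rewrite /= inordK //; lia.
Qed.

Theorem theorem9p2 (R : comNzRingType) (n : nat) (u v : 'S_n.+1)
    (I : seq 'I_n.+1) (hI : is_I_of v I) :
  [/\ (* F_I is a bijection from C0 u v to Rsub u I *)
      {in C0 u v, forall g, F I u g \in Rsub u I},
      {in C0 u v &, injective (F I u)},
      {in Rsub u I, forall J, exists2 g, g \in C0 u v & F I u g = J}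
    & {in C0 u v, forall g, SC R (F I u g) I = E R u v g}].
Proof.
have [redI /block_word_runs[k hk IE]] := hI.
have /andP[/andP[_ /eqP vE] _] := redI.
move: redI; rewrite -vE IE => redI; split.
- by move=> g /(F_correct hk redI)[].
- by move=> g1 g2 C1 C2; apply: F_inj hk redI _ _ _ C1 C2.
- by move=> J; apply: F_surj hk redI _ _.
- by move=> g gC; apply: SC_eq_E => //; apply: F_pairs hk redI _ _ gC.
Qed.
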